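(* Consider D$^2$/Exact-Diffusion with multiple gossip steps (defined in the context) for decentralized stochastic optimization with $n$ nodes, a symmetric doubly stochastic weight matrix $W$ of a strongly connected network, each $f_i$ $\mu$-strongly convex ($\mu>0$) and $L$-smooth, unbiased stochastic gradients with variance at most $\sigma^2$ and independent samples, $R=\lceil\frac{\ln(n)+4}{\sqrt{1-\beta}}\rceil$, and the learning rate and weights $h_k$ (specified in the context) for which the algorithm has the guarantee, with $T=KR$, $$\frac1{H_K}\sum_{k=0}^Kh_k\big(\mathbb E f(\bar x^{(k)})-f(x^\star)\big)=\tilde O\Big(\frac{\sigma^2}{nT}+\frac{\sigma^2}{n(1-\beta)^{1/2}T^2}+\exp\{-(1-\beta)^{1/2}T\}\Big).$$ Then the transient stage of this algorithm in the strongly convex scenario is on the order of $\tilde\Omega\big((1-\beta)^{-1/2}\big)$.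
   Context: Problem: $f=\frac1n\sum_{i=1}^n f_i$ with $f_i(x)=\mathbb E_{\xi_i\sim D_i}F(x;\xi_i)$, $x\in\mathbb R^d$; $x^\star$ the minimizer of $f$. Eigenvalues of $W$: $1=\lambda_1(W)>\lambda_2(W)\ge\dots\ge\lambda_n(W)>-1$; $\beta=\max\{|\lambda_2(W)|,|\lambda_n(W)|\}<1$. Fast gossip: $\eta=\frac{1-\sqrt{1-\beta^2}}{1+\sqrt{1-\beta^2}}$, $M^{(-1)}=M^{(0)}=I$, $M^{(r+1)}=(1+\eta)WM^{(r)}-\eta M^{(r-1)}$; $M=M^{(R)}$; $\bar M=(1-\tau)M+\tau I$, $\tau=\frac1{2n}$. Algorithm: $x_i^{(0)}=0$, $\psi_i^{(0)}=x_i^{(0)}$; for $k=0,1,\dots$ every node $i$ draws $R$ independent samples $\xi_i^{(k,r)}\sim D_i$ and sets $g_i^{(k)}=\frac1R\sum_{r=1}^R\nabla F(x_i^{(k)};\xi_i^{(k,r)})$, $\psi_i^{(k+1)}=x_i^{(k)}-\gamma g_i^{(k)}$, $\phi_i^{(k+1)}=\psi_i^{(k+1)}+x_i^{(k)}-\psi_i^{(k)}$, $x_i^{(k+1)}=\sum_j\bar M_{ij}\phi_j^{(k+1)}$. $\bar x^{(k)}=\frac1n\sum_ix_i^{(k)}$; $K$ is the number of outer iterations and $T=KR$ the total number of samples (or gossip communications). Learning rate: $\gamma=\min\{\frac1{4L},\frac{1-\tilde\beta}{26L}\frac{\tilde\lambda_n^{1/2}}{\tilde\lambda_2},\frac{2\ln(2n\mu\mathbb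 E\|\bar x^{(0)}-x^\star\|^2K^2/[\tilde\sigma^2(1-\tilde\beta)])}{\mu K}\}$ with $\tilde\sigma^2=\sigma^2/R$, $\tilde\lambda_2=\lambda_2(\bar M)$, $\tilde\lambda_n=\lambda_n(\bar M)$, $\tilde\beta=\max\{|\lambda_2(M)|,|\lambda_n(M)|\}$. Weights: $h_k>0$, $h_k=(1-\frac{\gamma\mu}2)h_{k+1}$, $H_K=\sum_{k=0}^Kh_k$. Transient stage: the number $T$ needed to reach the linear-speedup stage, i.e. the order of the smallest $T$ from which on the term of the rate bound involving $nT$ alone, here $\frac{\sigma^2}{nT}$, dominates the other terms of the bound up to absolute constants; the exponential term is regarded as negligible once $(1-\beta)^{1/2}T=\tilde\Omega(1)$. $\tilde O,\tilde\Omega$ hide logarithmic factors; $\sigma>0$ is treated as a constant. *)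

(* Defs.v *)
From HB Require Import structures.
From mathcomp Require Import all_boot all_order all_algebra.
From mathcomp Require Import all_classical all_reals all_analysis.

Set Implicit Arguments.
Unset Strict Implicit.
Unset Printing Implicit Defensive.

Import Order.TTheory GRing.Theory Num.Theory.
Import numFieldNormedType.Exports.

Local Open Scope ring_scope.
Local Open Scope classical_set_scope.

(* The library norm on ['rV[R]_d] is the sup norm; the Euclidean one is used
   throughout. *)
Definition dotp (R : realType) (d : nat) (u v : 'rV[R]_d) : R :=
  \sum_(j < d) u 0 j * v 0 j.

Definition sqnorm (R : realType) (d : nat) (u : 'rV[R]_d) : R := dotp u u.

Definition enorm (R : realType) (d : nat) (u : 'rV[R]_d) : R :=
  Num.sqrt (sqnorm u).

Definition grad (R : realType) (d : nat) (f : 'rV[R]_d -> R) (x : 'rV[R]_d) :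
    'rV[R]_d :=
  \row_(j < d) 'D_(delta_mx 0 j) f x.

Definition avg (R : realType) (n d : nat) (x : 'I_n -> 'rV[R]_d) : 'rV[R]_d :=
  n%:R^-1 *: \sum_(i < n) x i.

(* All eigenvalues of a matrix whose characteristic polynomial splits (in
   particular of a real symmetric matrix), with multiplicity and in
   nonincreasing order. *)
Definition spectrum (R : realType) (n : nat) (A : 'M[R]_n) : seq R :=
  xget [::] [set s : seq R |
    sorted >=%R s /\ char_poly A = \prod_(x <- s) ('X - x%:P)].

(* 1-based: [eig A 1] is the largest eigenvalue, [eig A n] the smallest. *)
Definition eig (R : realType) (n : nat) (A : 'M[R]_n) (k : nat) : R :=
  nth 0 (spectrum A) k.-1.

Definition beta (R : realType) (n : nat) (W : 'M[R]_n) : R :=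
  Num.max `|eig W 2| `|eig W n|.

Record weight_matrix (R : realType) (n : nat) (W : 'M[R]_n) : Prop := {
  wm_sym : W^T = W ;
  wm_ge0 : forall i j, 0 <= W i j ;
  wm_row : forall i, \sum_(j < n) W i j = 1 ;
  wm_col : forall j, \sum_(i < n) W i j = 1 ;
  wm_connected : forall i j, connect (fun u v : 'I_n => 0 < W u v) i j ;
  wm_eig1 : eig W 1 = 1 ;
  wm_eig2 : eig W 2 < 1 ;
  wm_eign : -1 < eig W n
}.

Definition gossip_eta (R : realType) (b : R) : R :=
  (1 - Num.sqrt (1 - b ^+ 2)) / (1 + Num.sqrt (1 - b ^+ 2)).

(* [(M^(r), M^(r-1))], with [M^(-1) = M^(0) = I]. *)
Fixpoint gossip_pair (R : realType) (n : nat) (W : 'M[R]_n) (r : nat) :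
    'M[R]_n * 'M[R]_n :=
  if r is s.+1 then
    let: (M, M') := gossip_pair W s in
    let eta := gossip_eta (beta W) in
    ((1 + eta) *: (W *m M) - eta *: M', M)
  else (1%:M, 1%:M).

Definition rounds (R : realType) (n : nat) (W : 'M[R]_n) : nat :=
  `|Num.ceil ((ln n%:R + 4) / Num.sqrt (1 - beta W))|%N.

Definition gossip (R : realType) (n : nat) (W : 'M[R]_n) : 'M[R]_n :=
  (gossip_pair W (rounds W)).1.

Definition gossip_bar (R : realType) (n : nat) (W : 'M[R]_n) : 'M[R]_n :=
  let tau := (2 * n%:R)^-1 in (1 - tau) *: gossip W + tau%:M.

Definition local_cost (R : realType) (n d : nat) (dX : measure_display)
    (X : measurableType dX) (D : 'I_n -> probability X R)
    (F : 'rV[R]_d -> X -> R) (i : 'I_n) (x : 'rV[R]_d) : R :=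
  fine (expectation (D i) (F x)).

Definition cost (R : realType) (n d : nat) (dX : measure_display)
    (X : measurableType dX) (D : 'I_n -> probability X R)
    (F : 'rV[R]_d -> X -> R) (x : 'rV[R]_d) : R :=
  n%:R^-1 * \sum_(i < n) local_cost D F i x.

Definition smooth (R : realType) (d : nat) (L : R) (f : 'rV[R]_d -> R) : Prop :=
  (forall x, differentiable f x) /\
  (forall x y, enorm (grad f x - grad f y) <= L * enorm (x - y)).

Definition strongly_convex (R : realType) (d : nat) (mu : R)
    (f : 'rV[R]_d -> R) : Prop :=
  forall x y, f x + dotp (grad f x) (y - x) + mu / 2 * sqnorm (y - x) <= f y.

Definition stoch_grad (R : realType) (d : nat) (dX : measure_display)
    (X : measurableType dX) (F : 'rV[R]_d -> X -> R)
    (x : 'rV[R]_d) (z : X) : 'rV[R]_d :=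
  grad (F ^~ z) x.

(* Measurability of the gradients in [z] follows from that of [F x], which is
   part of integrability. *)
Record stochastic_problem (R : realType) (n d : nat) (dX : measure_display)
    (X : measurableType dX) (D : 'I_n -> probability X R)
    (F : 'rV[R]_d -> X -> R) (mu L sigma : R) : Prop := {
  sp_int : forall i x, (D i).-integrable setT (EFin \o F x) ;
  sp_diff : forall x z, differentiable (F ^~ z) x ;
  sp_smooth : forall i, smooth L (local_cost D F i) ;
  sp_convex : forall i, strongly_convex mu (local_cost D F i) ;
  sp_grad_int : forall i x j,
    (D i).-integrable setT (fun z => (stoch_grad F x z 0 j)%:E) ;
  sp_unbiased : forall i x j,
    expectation (D i) (fun z => stoch_grad F x z 0 j)
      = (grad (local_cost D F i) x 0 j)%:E ;
  sp_variance : forall i x,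
    (expectation (D i)
       (fun z => sqnorm (stoch_grad F x z - grad (local_cost D F i) x)%R)
     <= (sigma ^+ 2)%:E)%E
}.

Definition mutually_independent (R : realType) (dO dX : measure_display)
    (O : measurableType dO) (X : measurableType dX) (P : probability O R)
    (I : eqType) (Y : I -> O -> X) : Prop :=
  forall (s : seq I) (A : I -> set X), uniq s ->
    (forall i, measurable (A i)) ->
    P (\big[setI/setT]_(i <- s) (Y i @^-1` A i))
      = (\prod_(i <- s) P (Y i @^-1` A i))%E.

(* [xi i k r] is the [r]-th sample drawn by node [i] at iteration [k]. *)
Record sampling (R : realType) (n : nat) (dO dX : measure_display)
    (O : measurableType dO) (X : measurableType dX) (P : probability O R)
    (D : 'I_n -> probability X R)
    (xi : 'I_n -> nat -> nat -> {RV P >-> X}) : Prop := {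
  sam_law : forall i k r (A : set X), measurable A ->
    distribution P (xi i k r) A = D i A ;
  sam_indep : mutually_independent P
    (fun t : 'I_n * nat * nat => (xi t.1.1 t.1.2 t.2 : O -> X))
}.

Definition x_init (R : realType) (n d : nat) (i : 'I_n) : 'rV[R]_d := 0.

(* [(x^(k), psi^(k))] at the outcome [w], with constant step size [gamma]. *)
Fixpoint exact_diffusion (R : realType) (n d : nat) (dO dX : measure_display)
    (O : measurableType dO) (X : measurableType dX) (P : probability O R)
    (W : 'M[R]_n) (F : 'rV[R]_d -> X -> R)
    (xi : 'I_n -> nat -> nat -> {RV P >-> X}) (gamma : R) (w : O) (k : nat) :
    ('I_n -> 'rV[R]_d) * ('I_n -> 'rV[R]_d) :=
  if k is l.+1 then
    let: (x, psi) := exact_diffusion W F xi gamma w l in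
    let g := fun i => (rounds W)%:R^-1 *:
      \sum_(r < rounds W) stoch_grad F (x i) (xi i l r w) in
    let psi' := fun i => x i - gamma *: g i in
    let phi' := fun i => psi' i + x i - psi i in
    (fun i => \sum_(j < n) gossip_bar W i j *: phi' j, psi')
  else (@x_init R n d, @x_init R n d).

Definition xbar (R : realType) (n d : nat) (dO dX : measure_display)
    (O : measurableType dO) (X : measurableType dX) (P : probability O R)
    (W : 'M[R]_n) (F : 'rV[R]_d -> X -> R)
    (xi : 'I_n -> nat -> nat -> {RV P >-> X}) (gamma : R) (k : nat) (w : O) :
    'rV[R]_d :=
  avg (exact_diffusion W F xi gamma w k).1.

Definition step_size (R : realType) (n d : nat) (dO : measure_display)
    (O : measurableType dO) (P : probability O R) (W : 'M[R]_n)
    (mu L sigma : R) (xs : 'rV[R]_d) (K : nat) : R :=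
  let tsigma2 := sigma ^+ 2 / (rounds W)%:R in
  let tlambda2 := eig (gossip_bar W) 2 in
  let tlambdan := eig (gossip_bar W) n in
  let tbeta := beta (gossip W) in
  let dist0 :=
    fine (expectation P (fun=> sqnorm (avg (@x_init R n d) - xs))) in
  Num.min (1 / (4 * L))
    (Num.min ((1 - tbeta) / (26 * L) * (Num.sqrt tlambdan / tlambda2))
       (2 * ln (2 * n%:R * mu * dist0 * K%:R ^+ 2 / (tsigma2 * (1 - tbeta)))
        / (mu * K%:R))).

(* The horizon [K] enters the step size, hence the weights too. *)
Definition averaging_weights (R : realType) (mu : R) (gamma : nat -> R)
    (h : nat -> nat -> R) : Prop :=
  forall K k, (0 < K)%N ->
    0 < h K k /\ h K k = (1 - gamma K * mu / 2) * h K k.+1.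

Definition weighted_error (R : realType) (n d : nat) (dO dX : measure_display)
    (O : measurableType dO) (X : measurableType dX) (P : probability O R)
    (W : 'M[R]_n) (D : 'I_n -> probability X R) (F : 'rV[R]_d -> X -> R)
    (xi : 'I_n -> nat -> nat -> {RV P >-> X}) (xs : 'rV[R]_d)
    (gamma : nat -> R) (h : nat -> nat -> R) (K : nat) : \bar R :=
  (((\sum_(k < K.+1) h K k)^-1)%:E *
   \sum_(k < K.+1) (h K k)%:E *
     (expectation P (fun w => cost D F (xbar W F xi (gamma K) k w))
      - (cost D F xs)%:E))%E.

(* The logarithmic factors hidden by the soft-O notation; used at [x >= 1]. *)
Definition polylog (R : realType) (C : R) (p : nat) (x : R) : R :=
  C * (1 + ln x) ^+ p.

Definition linear_term (R : realType) (sigma : R) (n T : nat) : R :=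
  sigma ^+ 2 / (n%:R * T%:R).

Definition network_term (R : realType) (sigma b : R) (n T : nat) : R :=
  sigma ^+ 2 / (n%:R * Num.sqrt (1 - b) * T%:R ^+ 2).

(* Log factors are hidden inside the exponential as well; [C = 1], [p = 0]
   gives [exp (- (1 - b)^(1/2) T)] itself. *)
Definition exp_term (R : realType) (C : R) (p : nat) (b : R) (n T : nat) : R :=
  expR (- (Num.sqrt (1 - b) * T%:R / polylog C p (n%:R * T%:R / (1 - b)))).

(* The number of samples per node is [T = K * rounds W]. *)
Definition rate_guarantee (R : realType) (C : R) (p : nat) (Ce : R) (pe : nat)
    (sigma : R) (n : nat) (W : 'M[R]_n) (err : nat -> \bar R) : Prop :=
  forall K T, (0 < K)%N -> T = (K * rounds W)%N ->
    (err K <= (polylog C p (n%:R * T%:R / (1 - beta W)) *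
               (linear_term sigma n T + network_term sigma (beta W) n T
                + exp_term Ce pe (beta W) n T))%:E)%E.

Definition linear_speedup_from (R : realType) (a Ce : R) (pe : nat)
    (sigma b : R) (n T0 : nat) : Prop :=
  (0 < T0)%N /\
  forall T, (T0 <= T)%N ->
    network_term sigma b n T <= a * linear_term sigma n T /\
    exp_term Ce pe b n T <= a * linear_term sigma n T.

Definition transient_stage (R : realType) (a Ce : R) (pe : nat)
    (sigma b : R) (n T0 : nat) : Prop :=
  linear_speedup_from a Ce pe sigma b n T0 /\
  forall T1, linear_speedup_from a Ce pe sigma b n T1 -> (T0 <= T1)%N.

(* Main.v *)
(** Write [s = sqrt (1 - beta)].  The network term is at most [a] times the
    linear one iff [a * s * T >= 1], which forces [T0 >= 1 / (a * s)].  The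
    exponential term is at most [a] times the linear one once [u = s * T]
    dominates a power of [1 + ln (n * T / (1 - beta))].  As [1 / s <= X] for
    [X = n / (1 - beta)], this is at most [2 * (1 + ln X) * (1 + ln u)], and
    the powers of [1 + ln u] are absorbed into [u]: it is enough that
    [u >= c * (1 + ln X) ^ (2 * (pe + 1))], so [T0] exceeds [1 / s] by at most
    a logarithmic factor. *)

Require Import Defs.
From HB Require Import structures.
From mathcomp Require Import all_boot all_order all_algebra.
From mathcomp Require Import all_classical all_reals all_analysis.
From mathcomp Require Import ring lra.

Set Implicit Arguments.
Unset Strict Implicit.
Unset Printing Implicit Defensive.

Import Order.TTheory GRing.Theory Num.Theory.
Import numFieldNormedType.Exports.

Local Open Scope ring_scope.

Lemma spectrum_sorted (R : realType) (n : nat) (A : 'M[R]_n) :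
  sorted >=%R (spectrum A).
Proof. by rewrite /spectrum; case: xgetP => [s _ []|]. Qed.

(** The default of [xget] is the empty list, so a nonempty spectrum is a genuine factorization of
    the characteristic polynomial, of degree [n]. *)
Lemma size_spectrum (R : realType) (n : nat) (A : 'M[R]_n) :
  spectrum A != [::] -> size (spectrum A) = n.
Proof.
rewrite /spectrum; case: xgetP => [s _ [_ As] _|_ /eqP //].
by apply: succn_inj; rewrite -(size_prod_XsubC s id) -As size_char_poly.
Qed.

Lemma beta_ge0 (R : realType) (n : nat) (W : 'M[R]_n) : 0 <= beta W.
Proof. by rewrite /beta le_max normr_ge0. Qed.

Lemma weight_matrix_beta_lt1 (R : realType) (n : nat) (W : 'M[R]_n) :
  (1 < n)%N -> weight_matrix W -> beta W < 1.
Proof.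
move=> n_gt1 [_ _ _ _ _ eig1 eig2 eign].
have sz : size (spectrum W) = n.
  (* An empty spectrum would make [eig W 1] the default [0] of [nth], not [1]. *)
  apply: size_spectrum; apply: contra_eq_neq eig1 => W0.
  by rewrite /eig W0 eq_sym oner_eq0.
have le_n2 : eig W n <= eig W 2.
  apply: (sorted_leq_nth (@ge_trans _ _) (@lexx _ _) 0 (spectrum_sorted W));
    by rewrite ?inE ?sz; case: n n_gt1 {W eig1 eig2 eign sz} => [|[]].
rewrite /beta gt_max !ltr_norml eig2 eign !andbT /=.
by rewrite (lt_le_trans eign le_n2) (le_lt_trans le_n2 eig2).
Qed.

(** Since [1 + x <= expR x] at [x = ln u / m], the base [1 + ln u] is at most [m] times the [m]-th
    root of [u]. *)
Lemma exprn_1Dln_le (R : realType) (u : R) (m : nat) : 1 <= u -> (0 < m)%N ->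
  (1 + ln u) ^+ m <= m%:R ^+ m * u.
Proof.
move=> u1 m0; have l0 : 0 <= ln u by exact: ln_ge0.
have m0R : 0 < m%:R :> R by rewrite ltr0n.
have m1R : 1 <= m%:R :> R by rewrite ler1n.
have ue : expR (ln u / m%:R) ^+ m = u.
  by rewrite -expRM_natl mulrC divfK ?gt_eqF// lnK// posrE (lt_le_trans ltr01).
rewrite -{2}ue -exprMn lerXn2r ?nnegrE; first by [].
- by rewrite addr_ge0.
- by rewrite mulr_ge0 ?expR_ge0// ltW.
apply: (@le_trans _ _ (m%:R * (1 + ln u / m%:R))).
  by rewrite mulrDr mulr1 mulrCA divff ?gt_eqF// mulr1 lerD2r.
by rewrite ler_pM2l// expR_ge1Dx.
Qed.

(* Squaring reduces the claim to [(1 + ln u) ^ (2q) <= (2q) ^ (2q) * u]. *)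
Lemma polylog_absorb (R : realType) (A Y u : R) (q : nat) : (0 < q)%N ->
  0 <= A -> 1 <= Y -> 1 <= u ->
  A ^+ 2 * (4 * q%:R) ^+ (2 * q) * Y ^+ (2 * q) <= u ->
  A * (2 * Y * (1 + ln u)) ^+ q <= u.
Proof.
move=> q0 A0 Y1 u1 Hu; have l0 : 0 <= ln u by exact: ln_ge0.
have u0 : 0 <= u by exact: le_trans u1.
have Y0 : 0 <= Y by exact: le_trans Y1.
have B0 : 0 <= A * (2 * Y * (1 + ln u)) ^+ q.
  by rewrite mulr_ge0// exprn_ge0// !mulr_ge0// addr_ge0.
rewrite -ler_sqr ?nnegrE// exprMn -exprM mulnC [in leRHS]expr2.
apply: le_trans (ler_wpM2r u0 Hu).
rewrite exprMn -!mulrA ler_wpM2l ?exprn_ge0//.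
(* The factor [2] pays for the one next to [Y], and [2 * q] is the constant of [exprn_1Dln_le] for
   the exponent [2 * q]. *)
have -> : (4 * q%:R : R) = 2 * (2 * q)%:R.
  by rewrite natrM; ring.
rewrite [in leRHS]exprMn !exprMn -!mulrA.
rewrite ler_wpM2l// ler_wpM2l ?exprn_ge0// [leRHS]mulrCA ler_wpM2l ?exprn_ge0//.
by apply: exprn_1Dln_le; rewrite // muln_gt0.
Qed.

Lemma polylog_ge (R : realType) (C x : R) (p : nat) : 0 <= C -> 1 <= x ->
  C <= polylog C p x.
Proof.
by move=> C0 x1; rewrite ler_peMr// exprn_ege1// lerDl ln_ge0.
Qed.

Lemma network_le_linear (R : realType) (a sigma b : R) (n T : nat) :
  0 < sigma -> b < 1 -> (0 < n)%N -> (0 < T)%N ->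
  (network_term sigma b n T <= a * linear_term sigma n T)
    = ((Num.sqrt (1 - b))^-1 <= a * T%:R).
Proof.
move=> s0 b1 n0 T0; rewrite /network_term /linear_term.
have nR : 0 < n%:R :> R by rewrite ltr0n.
have TR : 0 < T%:R :> R by rewrite ltr0n.
have sq : 0 < Num.sqrt (1 - b) by rewrite sqrtr_gt0 subr_gt0.
(* Both sides are multiples of this positive quantity. *)
set c := sigma ^+ 2 / (n%:R * T%:R ^+ 2).
have c0 : 0 < c by rewrite divr_gt0 ?mulr_gt0 ?exprn_gt0.
rewrite -[RHS](ler_pM2l c0) /c; congr (_ <= _).
  by rewrite !invfM; ring.
by field; rewrite !gt_eqF.
Qed.

(** After taking logarithms, [ln (n * T / (a * sigma ^+ 2))] times the polylog must be at most
    [s * T]. The last hypothesis is that of [polylog_absorb] with [q = pe.+1]: the polylog supplies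
    [pe] logarithmic factors and the logarithm one more. *)
Lemma exp_le_linear (R : realType) (a sigma Ce b : R) (pe n T : nat) :
  0 < sigma -> 0 < a -> 0 < Ce -> 0 <= b -> b < 1 -> (0 < n)%N ->
  let s := Num.sqrt (1 - b) in
  1 <= s * T%:R ->
  (Ce * (1 + `|ln (a * sigma ^+ 2)|)) ^+ 2 * (4 * pe.+1%:R) ^+ (2 * pe.+1)
    * (1 + ln (n%:R / (1 - b))) ^+ (2 * pe.+1) <= s * T%:R ->
  exp_term Ce pe b n T <= a * linear_term sigma n T.
Proof.
move=> s0 a0 Ce0 b0 b1 n0 s u1 Hu.
have b1' : 0 < 1 - b by rewrite subr_gt0.
have sp : 0 < s by rewrite sqrtr_gt0.
have s1 : s <= 1 by rewrite -sqrtr1 ler_wsqrtr// gerBl.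
have s2 : 1 - b = s ^+ 2 by rewrite sqr_sqrtr// ltW.
have nR : 1 <= n%:R :> R by rewrite ler1n.
have nR0 : 0 < n%:R :> R by rewrite ltr0n.
have TR : 1 <= T%:R :> R.
  by apply: (le_trans u1); rewrite ler_piMl.
have TR0 : 0 < T%:R :> R by exact: lt_le_trans TR.
set X := n%:R / (1 - b); set u := s * T%:R.
have X1 : 1 <= X by rewrite ler_pdivlMr// mul1r (le_trans _ nR)// gerBl.
have X0 : 0 < X by exact: lt_le_trans X1.
have u0 : 0 < u by exact: lt_le_trans u1.
have lX : 0 <= ln X by exact: ln_ge0.
have lu : 0 <= ln u by exact: ln_ge0.
have XT : n%:R * T%:R / (1 - b) = X * T%:R by rewrite mulrAC.
(* As [X = n / s ^+ 2], this amounts to [s <= n]. *)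
have sX : s^-1 <= X.
  rewrite /X s2 ler_pdivlMr ?exprn_gt0// expr2 mulKf ?gt_eqF//.
  exact: le_trans nR.
have Tle : T%:R <= X * u.
  by rewrite -[leLHS](mulKf (lt0r_neq0 sp)) ler_wpM2r// ltW.
have lXT : 0 <= ln (X * T%:R) by rewrite ln_ge0// mulr_ege1.
(* By [Tle], [ln (X * T)] is at most [2 * ln X + ln u]; the cross term [ln X * ln u] is
   nonnegative. *)
have lXT2 : 1 + ln (X * T%:R) <= 2 * (1 + ln X) * (1 + ln u).
  have : ln T%:R <= ln (X * u) by rewrite ler_ln// posrE mulr_gt0.
  by rewrite (lnM X0 TR0) (lnM X0 u0); have := mulr_ge0 lX lu; nra.
set c := 1 + `|ln (a * sigma ^+ 2)|.
have c0 : 0 < c by rewrite ltr_pwDl.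
have pl0 : 0 < polylog Ce pe (X * T%:R).
  by rewrite mulr_gt0// exprn_gt0// ltr_pwDl.
have as0 : 0 < a * sigma ^+ 2 by rewrite mulr_gt0 ?exprn_gt0.
have log_nT : ln (n%:R * T%:R) - ln (a * sigma ^+ 2) <= c * (1 + ln (X * T%:R)).
  have : ln (n%:R * T%:R : R) <= ln (X * T%:R).
    rewrite ler_ln ?posrE; [|exact: mulr_gt0..].
    by rewrite ler_pM2r// ler_pdivlMr// ler_piMr ?(ltW nR0)// gerBl.
  have := ler_norm (- ln (a * sigma ^+ 2)); rewrite normrN.
  have := mulr_ge0 (normr_ge0 (ln (a * sigma ^+ 2))) lXT.
  rewrite /c; lra.
rewrite /exp_term /linear_term XT mulrA -/s -/u.
rewrite -[leRHS]lnK ?posrE ?divr_gt0 ?mulr_gt0// ler_expR.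
rewrite ln_div ?posrE ?mulr_gt0// -lerNl opprB.
apply: (le_trans log_nT); rewrite ler_pdivlMr//.
have Cec0 : 0 <= Ce * c by rewrite ltW// mulr_gt0.
have Y1 : 1 <= 1 + ln X by rewrite lerDl.
apply: le_trans (polylog_absorb (ltn0Sn pe) Cec0 Y1 u1 Hu).
have -> : c * (1 + ln (X * T%:R)) * polylog Ce pe (X * T%:R)
    = Ce * c * (1 + ln (X * T%:R)) ^+ pe.+1 by rewrite /polylog exprS; ring.
rewrite ler_pM2l ?mulr_gt0// lerXn2r ?nnegrE ?mulr_ge0 ?addr_ge0//.
Qed.

Theorem corollary4 (R : realType) (sigma : R) (C Ce a : R) (p pe : nat) :
  0 < sigma -> 0 < C -> 0 < Ce -> 0 < a ->
  exists (C' : R) (p' : nat), 0 < C' /\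
  forall (n d : nat) (W : 'M[R]_n)
         (dX : measure_display) (X : measurableType dX)
         (D : 'I_n -> probability X R) (F : 'rV[R]_d -> X -> R) (mu L : R)
         (xs : 'rV[R]_d)
         (dO : measure_display) (O : measurableType dO) (P : probability O R)
         (xi : 'I_n -> nat -> nat -> {RV P >-> X}) (h : nat -> nat -> R),
    (1 < n)%N -> weight_matrix W ->
    0 < mu -> 0 < L ->
    stochastic_problem D F mu L sigma ->
    (forall x, cost D F xs <= cost D F x) ->
    sampling D xi ->
    let gamma := step_size P W mu L sigma xs in
    averaging_weights mu gamma h ->
    let err := weighted_error W D F xi xs gamma h in
    rate_guarantee C p Ce pe sigma W err ->
    let b := beta W in
    let ell := polylog C' p' (n%:R / (1 - b)) in
    exists T0 : nat,
      [/\ transient_stage a Ce pe sigma b n T0,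
          (Num.sqrt (1 - b))^-1 / ell <= T0%:R,
          T0%:R <= ell * (Num.sqrt (1 - b))^-1
        & forall K T, (0 < K)%N -> T = (K * rounds W)%N -> (T0 <= T)%N ->
            (err K <= ((1 + 2 * a) * polylog C p (n%:R * T%:R / (1 - b))
                       * linear_term sigma n T)%:E)%E].
Proof.
move=> sigma0 C0 Ce0 a0.
set q := pe.+1.
(* The summands ensure, in order, [1 <= s * T], the network comparison, and the hypothesis of
   [exp_le_linear]. *)
pose c1 : R := 1 + a^-1 +
  (Ce * (1 + `|ln (a * sigma ^+ 2)|)) ^+ 2 * (4 * q%:R) ^+ (2 * q).
have A0 : 0 <= (Ce * (1 + `|ln (a * sigma ^+ 2)|)) ^+ 2 * (4 * q%:R) ^+ (2 * q).
  by rewrite mulr_ge0 ?exprn_ge0 ?mulr_ge0 ?addr_ge0// ltW.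
have ai0 : 0 < a^-1 by rewrite invr_gt0.
have c1_ge1 : 1 <= c1 by rewrite /c1; lra.
(* [c1] gives the upper bound on [T0], [1] absorbs the rounding up of the threshold, and [a] serves
   the lower bound. *)
exists (c1 + 1 + a), (2 * q)%N; split; first lra.
move=> n d W dX X D F mu L xs dO O P xi h n_gt1 HW _ _ _ _ _ gamma _ err rate.
move=> b ell.
have b1 : b < 1 by exact: weight_matrix_beta_lt1.
have b0 : 0 <= b by exact: beta_ge0.
have n0 : (0 < n)%N by exact: ltnW.
have n1R : 1 <= n%:R :> R by rewrite ler1n.
have b1' : 0 < 1 - b by rewrite subr_gt0.
set s := Num.sqrt (1 - b) in ell *.
have s0 : 0 < s by rewrite sqrtr_gt0.
have s1 : s <= 1 by rewrite -sqrtr1 ler_wsqrtr// gerBl.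
have si1 : 1 <= s^-1 by rewrite invf_ge1.
have X1 : 1 <= n%:R / (1 - b).
  by rewrite ler_pdivlMr// mul1r (le_trans _ n1R)// gerBl.
set Y : R := (1 + ln (n%:R / (1 - b))) ^+ (2 * q).
have Y1 : 1 <= Y by rewrite exprn_ege1// lerDl ln_ge0.
have speedup_ge (T : nat) : c1 * Y / s <= T%:R -> (0 < T)%N /\
    (network_term sigma b n T <= a * linear_term sigma n T /\
     exp_term Ce pe b n T <= a * linear_term sigma n T).
  rewrite ler_pdivrMr// [leRHS]mulrC => HT.
  have c1Y : c1 <= c1 * Y by rewrite ler_peMr// (le_trans ler01).
  have sT1 : 1 <= s * T%:R by lra.
  have T0 : (0 < T)%N.
    by rewrite lt0n; apply: contraTneq sT1 => ->; rewrite mulr0 ler10.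
  split=> //; split.
    rewrite network_le_linear// -/s -div1r ler_pdivrMr//.
    have : a^-1 <= s * T%:R by rewrite /c1 in c1Y HT; lra.
    by rewrite -div1r ler_pdivrMr// mulrC mulrA mulrAC.
  apply: exp_le_linear => //; apply: le_trans HT.
  by rewrite ler_wpM2r ?(le_trans ler01)// /c1; lra.
pose T1 := `|Num.ceil (c1 * Y / s)|%N.
have T1E : T1%:R = (Num.ceil (c1 * Y / s))%:~R :> R.
  rewrite /T1 natr_absz ger0_norm// ceil_ge0 (lt_le_trans (ltrN10 _))//.
  by rewrite !mulr_ge0 ?invr_ge0 ?(ltW s0)// (le_trans ler01).
have T1_ge : c1 * Y / s <= T1%:R by rewrite T1E ceil_ge.
have T1_le : T1%:R <= c1 * Y / s + 1.
  by have := ceilB1_lt (c1 * Y / s); rewrite T1E intrB; lra.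
have speedT1 : linear_speedup_from a Ce pe sigma b n T1.
  split; first by case: (speedup_ge _ T1_ge).
  move=> T leT; apply: (speedup_ge T _).2; apply: (le_trans T1_ge).
  by rewrite ler_nat.
(* The explicit threshold [T1] shows that the set of admissible thresholds is nonempty; [T0] is its
   least element. *)
have ex_speedup : exists T0, `[< linear_speedup_from a Ce pe sigma b n T0 >].
  by exists T1; apply/asboolP.
case: (ex_minnP ex_speedup) => T0 /asboolP speedT0 minT0.
have {}minT0 T : linear_speedup_from a Ce pe sigma b n T -> (T0 <= T)%N.
  by move=> ?; apply/minT0/asboolP.
have [T0_gt0 T0_speedup] := speedT0.
exists T0; split=> //.
(* The network comparison at [T = T0] itself forces [s^-1 <= a * T0], and [a <= ell]. *)
- have [+ _] := T0_speedup _ (leqnn T0); rewrite network_le_linear// -/s => le_aT0.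
  have a_le : a <= ell.
    by apply: (@le_trans _ _ (c1 + 1 + a)); [lra|apply: polylog_ge => //; lra].
  by rewrite ler_pdivrMr ?(lt_le_trans a0)// mulrC (le_trans le_aT0)// ler_wpM2r.
- have T01 : T0%:R <= T1%:R :> R by rewrite ler_nat minT0.
  apply: (le_trans T01); apply: (le_trans T1_le).
  rewrite /ell /polylog -/Y.
  (* The [1] lost to the ceiling is at most [Y / s]. *)
  have : 1 * 1 <= Y * s^-1 by rewrite ler_pM.
  have : 0 <= a * (Y * s^-1) by rewrite !mulr_ge0 ?(ltW a0)// (le_trans ler01).
  by lra.
(* Past [T0] the network and exponential terms each cost at most [a] linear terms, hence
   [1 + 2 * a]. *)
- move=> K T K0 TE leT; apply: le_trans (rate K T K0 TE) _.
  have [net ex] := T0_speedup _ leT.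
  rewrite lee_fin -/b; set pl := polylog C p _.
  rewrite (mulrC _ pl) -[leRHS]mulrA ler_wpM2l //; last lra.
  apply/ltW/(lt_le_trans C0)/polylog_ge; first exact: ltW.
  by rewrite mulrAC mulr_ege1// ler1n; exact: leq_trans leT.
Qed.
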